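(* Let $X$ be a separable metric space which is analytic and countable dense homogeneous (CDH). Then $X$ is completely Baire.
   Context: A separable topological space $X$ is countable dense homogeneous (CDH) if for any two countable dense subsets $D, D' \subseteq X$ there is a homeomorphism $h : X \to X$ such that $h[D]=D'$. A separable metric space is analytic if it is a continuous image of the Baire space $\omega^\omega$. A topological space is Baire if the complement of every meager subset is dense. A topological space is completely Baire if all of its closed subspaces are Baire. *)

(* Defs.v *)
From HB Require Import structures.
From mathcomp Require Import all_boot all_order all_algebra.
From mathcomp Require Import all_classical all_reals topology.

Set Implicit Arguments.
Unset Strict Implicit.
Unset Printing Implicit Defensive.

Local Open Scope classical_set_scope.

Definition separable_space (T : topologicalType) : Prop :=
  exists2 D : set T, countable D & dense D.

Definition homeomorphism (T U : topologicalType) (h : T -> U) : Prop :=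
  continuous h /\
  exists g : U -> T, [/\ continuous g, cancel h g & cancel g h].

(* [countable] allows finite sets. *)
Definition countable_dense_homogeneous (T : topologicalType) : Prop :=
  separable_space T /\
  forall D D' : set T,
    countable D -> dense D -> countable D' -> dense D' ->
    exists2 h : T -> T, homeomorphism h & h @` D = D'.

(* [{ptws nat -> nat}] is the Baire space: the product topology of countably
   many copies of the discrete space [nat]. *)
Definition analytic_space (T : topologicalType) : Prop :=
  exists2 f : {ptws nat -> nat} -> T, continuous f & range f = setT.

Definition nowhere_dense (T : topologicalType) (A : set T) : Prop :=
  (closure A)° = set0.

Definition meager (T : topologicalType) (A : set T) : Prop :=
  exists2 F : nat -> set T,
    forall n, nowhere_dense (F n) & A = \bigcup_n F n.

Definition baire_space (T : topologicalType) : Prop :=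
  forall A : set T, meager A -> dense (~` A).

(* [set_type C] carries the initial topology of the inclusion into [T], i.e.
   the usual subspace topology; the library's [subspace C] does not fit here,
   since its carrier is all of [T], with the points outside [C] isolated. *)
Definition completely_baire (T : topologicalType) : Prop :=
  forall C : set T, closed C -> baire_space (set_type C).

(* Main.v *)
Require Import Defs.
From mathcomp Require Import all_boot all_order all_algebra.
From mathcomp Require Import all_classical all_reals topology.

(** Fix a continuous surjection [f] from the Baire space onto [X].

    The key notion is that of a continuous section of [f] over a set [D]. It
    embeds [D] in the Baire space, and the Baire category theorem there gives
    [continuous_section_avoid]: if closed sets [E k] are such that each
    [D `\` E k] is dense in [D], then some point of [closure D] avoids all of
    them. Hence, if every countable subset of [X] has a continuous section (with
    respect to some [f]), every closed subspace [C] is Baire: were a nonempty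
    open subset of [C] covered by nowhere dense sets, a countable dense subset of
    it would contradict this property.

    If [X] is itself Baire, a section exists over some countable dense set
    ([baire_continuous_section]): a non-meager image of a cylinder splits into
    countably many images, one of which is non-meager, and following the first
    such choice assigns to every point of a comeager set a branch whose initial
    segments are locally constant functions of the point. Countable dense
    homogeneity then carries the section to a dense set containing any prescribed
    countable set ([analytic_cdh_section]).

    It remains to see that [X] is Baire ([analytic_cdh_baire]). The union [U] of
    all meager open sets is preserved by every homeomorphism. If [U] is nonempty,
    a diagonal construction gives a countable set dense in [U] which meets each
    member of some closed cover of [U] in a finite set; by homogeneity all
    countable subsets of [U] have this property ([cdh_thin]). In an uncountable
    analytic set this fails by a category argument ([thin_countable]), so [U] is
    countable; but it has no isolated points, so that [U] and [U] minus a point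
    are both countable and dense in [U], which contradicts homogeneity. *)

Set Implicit Arguments.
Unset Strict Implicit.
Unset Printing Implicit Defensive.

Import Order.TTheory GRing.Theory Num.Theory.
Local Open Scope classical_set_scope.

Local Notation omega_omega := {ptws nat -> nat}.

(** * Nowhere dense and meager sets *)

Lemma nowhere_denseP (T : topologicalType) (A : set T) :
  nowhere_dense A <-> forall O, open O -> O !=set0 ->
    exists P, [/\ open P, P !=set0, P `<=` O & P `<=` ~` A].
Proof.
split=> [A0 O oO [x Ox]|h]; last first.
  rewrite /nowhere_dense -subset0 => x xA.
  have [||P [oP [y Py] PA PnA]] := h (closure A)°; first exact: open_interior.
    by exists x.
  have /PA/interior_subset/(_ P) := Py.
  case=> [|z [Az Pz]]; first exact: open_nbhs_nbhs.
  exact: PnA Az.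
have : ~ (O `<=` closure A).
  by move=> /interiorS; rewrite A0 (interior_id _).1 // => /(_ _ Ox).
move=> /existsNP[y /not_implyP[Oy nAy]]; exists (O `\` closure A); split.
- by rewrite setDE; apply: openI => //; apply: closed_openC; exact: closed_closure.
- by exists y.
- exact: subDsetl.
- by move=> z [_ nAz] Az; apply: nAz; exact: subset_closure.
Qed.

Lemma nowhere_dense0 (T : topologicalType) : nowhere_dense (@set0 T).
Proof. by rewrite /nowhere_dense closure0 interior0. Qed.

(** Covers suffice because a subset of a nowhere dense set is nowhere dense; any
    countable index type may be coded into [nat]. *)
Lemma meager_cover (T : topologicalType) (I : countType) (F : I -> set T)
    (A : set T) :
  (forall i, nowhere_dense (F i)) -> A `<=` \bigcup_i F i -> meager A.
Proof.
move=> F0 AF.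
exists (fun n => if unpickle n is Some i then A `&` F i else set0); last first.
  apply/seteqP; split=> [x Ax|x [m _]]; last by case: unpickle => // i [].
  by have [i _ Fix] := AF x Ax; exists (pickle i) => //; rewrite pickleK.
move=> n; case: unpickle => [i|]; last exact: nowhere_dense0.
rewrite /nowhere_dense -subset0 -(F0 i); apply: interiorS; apply: closureS.
exact: subIsetr.
Qed.

Lemma meagerS (T : topologicalType) (A B : set T) :
  A `<=` B -> meager B -> meager A.
Proof. by move=> AB [F F0 BF]; apply: (meager_cover F0); rewrite -BF. Qed.

Lemma nowhere_dense_meager (T : topologicalType) (A : set T) :
  nowhere_dense A -> meager A.
Proof.
by move=> A0; apply: (@meager_cover _ unit (fun=> A)) => // x Ax; exists tt.
Qed.

Lemma meager_bigcup (T : topologicalType) (I : countType) (D : set I)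
    (F : I -> set T) :
  (forall i, D i -> meager (F i)) -> meager (\bigcup_(i in D) F i).
Proof.
move=> Fm.
have /choice[G GP] i : exists G : nat -> set T,
    (forall n, nowhere_dense (G n)) /\ (D i -> F i = \bigcup_n G n).
  have [/Fm[G G0 FG]|nDi] := pselect (D i); first by exists G.
  by exists (fun=> set0); split=> // _; exact: nowhere_dense0.
apply: (@meager_cover _ (I * nat)%type (fun p => G p.1 p.2)).
  by move=> p; exact: (GP p.1).1.
move=> x [i Di]; rewrite ((GP i).2 Di) => -[n _ Gx].
by exists (i, n).
Qed.

Lemma meagerU (T : topologicalType) (A B : set T) :
  meager A -> meager B -> meager (A `|` B).
Proof.
move=> mA mB.
apply: (@meagerS _ _ (\bigcup_(b in [set: bool]) if b then A else B)).
  by move=> x [Ax|Bx]; [exists true|exists false].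
by apply: meager_bigcup => -[].
Qed.

Lemma nowhere_dense_boundary (X : topologicalType) (O : set X) :
  open O -> nowhere_dense (closure O `\` O).
Proof.
move=> oO; apply/nowhere_denseP => P oP P0.
have [[x [Px Ox]]|PO] := pselect (P `&` O !=set0).
  by exists (P `&` O); split; [exact: openI|exists x|move=> ? []|move=> ? [_ Oy] []].
exists P; split=> // x Px [Ox nOx]; apply: PO.
have [y [Oy Py]] := Ox P (open_nbhs_nbhs (conj oP Px)).
by exists y.
Qed.

Lemma nowhere_dense_avoid (X : topologicalType) (F : nat -> set X) n (O : set X) :
    (forall i, nowhere_dense (F i)) -> open O -> O !=set0 ->
  exists P, [/\ open P, P !=set0, P `<=` O & forall i, i < n -> P `<=` ~` F i].
Proof.
move=> F0 oO O0; elim: n => [|n [P [oP P0 PO PF]]]; first by exists O; split.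
have [Q [oQ Q0 QP QF]] := (nowhere_denseP (F n)).1 (F0 n) P oP P0.
exists Q; split=> //; first exact: subset_trans PO.
move=> i; rewrite ltnS leq_eqVlt => /predU1P[->//|/PF].
exact: subset_trans.
Qed.

Lemma image_inverse (X Y : Type) (h : X -> Y) (g : Y -> X) (A : set X) :
  cancel h g -> cancel g h -> h @` A = g @^-1` A.
Proof.
move=> hK gK; apply/seteqP; split=> [_ [x Ax <-]|y Ay] /=; first by rewrite hK.
by exists (g y).
Qed.

(** An open set is pulled back along [h], shrunk there off a nowhere dense set,
    and the result is pulled back along the inverse of [h]. *)
Lemma homeomorphism_meager (X Y : topologicalType) (h : X -> Y) (A : set X) :
  homeomorphism h -> meager A -> meager (h @` A).
Proof.
move=> [hc [g [gc hK gK]]] [F F0 ->].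
apply: (@meager_cover _ nat (fun n => h @` F n)) => [n|_ [x [n _ Fx] <-]]; last first.
  by exists n => //; exists x.
apply/nowhere_denseP => O oO [y Oy].
have [||P [oP [x Px] PO PF]] := (nowhere_denseP (F n)).1 (F0 n) (h @^-1` O).
- by apply: open_comp => // x _; exact: hc.
- by exists (g y); rewrite /= gK.
exists (g @^-1` P); split.
- by apply: open_comp => // z _; exact: gc.
- by exists (h x); rewrite /= hK.
- by move=> z /PO /=; rewrite gK.
- by move=> z Pz; rewrite (image_inverse _ hK gK); exact: PF.
Qed.

(** * Countable bases and countable dense subsets *)

Lemma countableU (T : Type) (A B : set T) :
  countable A -> countable B -> countable (A `|` B).
Proof.
by move=> cA cB; rewrite -bigcup2E; apply: bigcup_countable => [|[|[|n]] _].
Qed.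

Definition dense_in (X : topologicalType) (U S : set X) :=
  forall O, open O -> U `&` O !=set0 -> S `&` O !=set0.

Definition open_base (T : topologicalType) (B : nat -> set T) :=
  (forall n, open (B n)) /\
  forall O x, open O -> O x -> exists2 n, B n x & B n `<=` O.

(** The interiors of the balls of radius 1/(j+1) around points of a countable
    dense set form a base. *)
Lemma separable_metric_open_base (R : realType) (X : metricType R) :
  separable_space X -> exists B : nat -> set X, open_base B.
Proof.
move=> [D /countable_injP[code codeI] dD].
pose ctr i := [set d | D d /\ code d = i].
pose B n : set X := if unpickle n is Some (i, j)
  then \bigcup_(d in ctr i) (ball d (j.+1%:R^-1 : R)%R)° else set0.
exists B; split=> [n|O x oO Ox].
  rewrite /B; case: unpickle => [[i j]|]; last exact: open0.
  by apply: bigcup_open => d _; exact: open_interior.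
have /nbhs_ballP[e /= e0 xeO] : nbhs x O by exact: open_nbhs_nbhs.
have [j] := ltr_add_invr (divr_gt0 e0 (ltr0n R 2)).
rewrite add0r; set dl := (_^-1)%R => dle.
have dl0 : (0 < dl)%R by rewrite invr_gt0 ltr0n.
have dl20 : (0 < dl / 2)%R by rewrite divr_gt0.
have [d [/interior_subset xd Dd]] : (ball x (dl / 2))%R° `&` D !=set0.
  apply: dD; last exact: open_interior.
  by exists x; exact: nbhsx_ballx.
exists (pickle (code d, j)); rewrite /B pickleK.
  exists d => //; rewrite -/dl; apply: filterS (nbhsx_ballx x _ dl20) => y xy.
  by rewrite [dl]splitr; apply: ball_triangle xy; exact: ball_sym.
move=> y [d' [Dd' /codeI d'd]]; rewrite d'd ?inE//.
move=> /interior_subset; rewrite -/dl => dy.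
apply: xeO; rewrite [e]splitr; apply: (@ball_triangle _ _ d).
  apply: le_ball xd; apply: le_trans (ltW dle).
  by rewrite ler_pdivrMr// ler_peMr ?ler1n ?ltW.
exact: le_ball (ltW dle) _ dy.
Qed.

Lemma countable_dense_subset (T : topologicalType) (B : nat -> set T) (S : set T) :
  open_base B -> exists D, [/\ countable D, D `<=` S & dense_in S D].
Proof.
move=> [oB baseB]; have [[x0 Sx0]|S0] := pselect (S !=set0); last first.
  by exists set0; split=> // O _ [x [Sx _]]; case: S0; exists x.
have /choice[d dP] n : exists d, S d /\ (S `&` B n !=set0 -> B n d).
  have [[x [Sx Bx]]|nSB] := pselect (S `&` B n !=set0); first by exists x.
  by exists x0; split=> // /nSB.
exists (range d); split=> [|_ [n _ <-]|O oO [x [Sx Ox]]].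
- exact: card_image_le.
- exact: (dP n).1.
- have [n Bx BO] := baseB O x oO Ox.
  exists (d n); split; first by exists n.
  by apply: BO; apply: (dP n).2; exists x.
Qed.

(** * Category in the Baire space *)

(** The first [k] values of [s], latest first: prolonging an initial segment is
    then a [cons], which makes recursions over the tree of segments structural. *)
Fixpoint past (s : nat -> nat) (k : nat) : seq nat :=
  if k is j.+1 then s j :: past s j else [::].

Definition cyl (t : seq nat) : set omega_omega :=
  [set s : nat -> nat | past s (size t) = t].

Lemma size_past s k : size (past s k) = k.
Proof. by elim: k => //= k ->. Qed.

Lemma cyl_past s k : cyl (past s k) s.
Proof. by rewrite /cyl /= size_past. Qed.

Lemma cyl_cons n t : cyl (n :: t) = cyl t `&` (proj (size t) @^-1` [set n]).
Proof. by apply/seteqP; split=> s /=; rewrite /cyl/= /proj => -[-> ->]. Qed.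

Lemma cyl_open t : open (cyl t).
Proof.
elim: t => [|n t IH].
  by rewrite (_ : cyl _ = setT); [exact: openT|exact/seteqP].
rewrite cyl_cons; apply: openI => //.
move: [set n] (discrete_open [set n]).
apply/(@continuousP omega_omega nat).
exact: (@proj_continuous nat (fun=> nat) (size t)).
Qed.

Lemma nbhs_cyl (s : omega_omega) (A : set omega_omega) :
  nbhs s A -> exists k, cyl (past s k) `<=` A.
Proof.
pose F := filter_from setT (fun k => cyl (past s k)).
have FF : Filter F.
  apply: filter_from_filter; first by exists 0.
  suff mono m n : m <= n -> cyl (past s n) `<=` cyl (past s m).
    move=> m n _ _; exists (maxn m n) => // x mn; split; apply: mono mn.
      exact: leq_maxl.
    exact: leq_maxr.
  move=> /subnK <-; elim: (n - m)%N => // j IH x; rewrite addSn /= cyl_cons => -[+ _].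
  exact: IH.
suff Fs : F --> s by move=> /Fs[k _ ?]; exists k.
apply/pointwise_cvgP => n B /= /nbhs_singleton Bn.
by exists n.+1 => // x /=; rewrite cyl_cons /= /proj size_past => -[_ ->].
Qed.

Lemma eq_past s s' k : past s k = past s' k <-> forall i, i < k -> s i = s' i.
Proof.
elim: k => [|k IH] /=; first by split.
split=> [[sk /IH ss'] i|ss'].
  by rewrite ltnS leq_eqVlt => /predU1P[->//|]; exact: ss'.
by congr cons; [exact: ss'|apply/IH => i ik; apply: ss'; exact: leqW].
Qed.

Lemma cyl_coord t (s s' : omega_omega) :
  cyl t s -> cyl t s' -> forall i, i < size t -> s i = s' i.
Proof. by move=> ts ts'; apply/eq_past; rewrite ts ts'. Qed.

Lemma cylS t (s : omega_omega) k :
  cyl t s -> k <= size t -> cyl t `<=` cyl (past s k).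
Proof.
move=> ts kt s' ts'; rewrite /cyl/= size_past; apply/eq_past => i ik.
exact: (cyl_coord ts' ts) (leq_trans ik kt).
Qed.

(** The Baire category theorem for the closed subspace [closure R] of the Baire
    space. Only points of [R] are used along the way, so that the density
    hypotheses can be checked on a countable set [R]. *)
Lemma omega_omega_baire (R : set omega_omega) (E : nat -> set omega_omega) :
    R !=set0 -> (forall k, closed (E k)) ->
    (forall k, dense_in R (R `\` E k)) ->
  exists2 s, closure R s & forall k, ~ E k s.
Proof.
move=> [r0 Rr0] cE RE.
have /choice[step stepP] (kt : nat * seq nat) : exists t', R `&` cyl kt.2 !=set0 ->
    [/\ R `&` cyl t' !=set0, cyl t' `<=` cyl kt.2 `\` E kt.1 & size kt.2 < size t'].
  case: kt => k t /=.
  have [Rt|nRt] := pselect (R `&` cyl t !=set0); last by exists t => /nRt.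
  have [s [[Rs nEs] ts]] := RE k _ (cyl_open t) Rt.
  have /nbhs_cyl[m sm] : nbhs s (cyl t `\` E k).
    by apply: open_nbhs_nbhs; split=> //; rewrite setDE; apply: openI;
      [exact: cyl_open|exact: closed_openC].
  exists (past s (maxn m (size t).+1)) => _; split.
  - by exists s; split=> //; exact: cyl_past.
  - apply: subset_trans sm; apply: cylS; first exact: cyl_past.
    by rewrite size_past leq_maxl.
  - by rewrite size_past leq_maxr.
pose T := fix T k := if k is j.+1 then step (j, T j) else [::].
have TR k : R `&` cyl (T k) !=set0.
  by elim: k => [|k IH] /=; [exists r0|have [] := stepP (k, T k) IH].
have TS k : cyl (T k.+1) `<=` cyl (T k) `\` E k by have [] := stepP (k, T k) (TR k).
have Tsize k : k <= size (T k).
  elim: k => // k IH; apply: leq_ltn_trans IH _.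
  by have [] := stepP (k, T k) (TR k).
have Tmono j k : j <= k -> cyl (T k) `<=` cyl (T j).
  move=> /subnK <-; elim: (k - j)%N => // d IH; rewrite addSn.
  by apply: subset_trans IH => x /TS[].
have /choice[r rP] := TR.
(* The segment [T i.+1] has length at least [i.+1], so it determines the value
   at [i]; [r i.+1] extends it. *)
pose s : omega_omega := fun i => r i.+1 i.
have Ts k : cyl (T k) s.
  rewrite /cyl/= -[RHS](rP k).2; apply/eq_past => i ik; rewrite /s.
  have rm := (rP (maxn i.+1 k)).2.
  rewrite (cyl_coord (rP i.+1).2 (Tmono _ _ (leq_maxl _ _) _ rm)) ?Tsize//.
  exact: (cyl_coord (Tmono _ _ (leq_maxr _ _) _ rm) (rP k).2).
exists s => [A /nbhs_cyl[k kA]|k]; last by have /TS[] := Ts k.+1.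
have [x [Rx Tx]] := TR k; exists x; split=> //; apply: kA.
exact: cylS (Ts k) (Tsize k) _ Tx.
Qed.

Lemma omega_omega_base : exists B : nat -> set omega_omega, open_base B.
Proof.
exists (fun n => if unpickle n is Some t then cyl t else set0).
split=> [n|O s oO Os]; first by case: unpickle => [t|]; [exact: cyl_open|exact: open0].
have [k sk] := nbhs_cyl (open_nbhs_nbhs (conj oO Os)).
by exists (pickle (past s k)); rewrite pickleK//; exact: cyl_past.
Qed.

(** * Continuous sections *)

Definition continuous_section (X : topologicalType) (f : omega_omega -> X)
    (D : set X) :=
  exists2 b : X -> omega_omega, {within D, continuous b} &
    forall x, D x -> f (b x) = x.

(** A continuous section transports [D] homeomorphically into the Baire space, so
    the Baire category theorem applies to the closure of its image there; the
    limit found upstairs is sent by [f] to the required point. Thus a set with a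
    continuous section behaves like a subset of a completely metrizable space. *)
Lemma continuous_section_avoid (X : topologicalType) (f : omega_omega -> X)
    (D : set X) (E : nat -> set X) :
    continuous f -> continuous_section f D ->
    D !=set0 -> (forall k, closed (E k)) ->
    (forall k, dense_in D (D `\` E k)) ->
  exists2 x, closure D x & forall k, ~ E k x.
Proof.
move=> fc [b /subspace_continuousP bc bK] [d0 Dd0] cE DE.
have [||k P oP [_ [[d Dd <-] Pd]]|s Rs Es] :=
  @omega_omega_baire (b @` D) (fun k => f @^-1` E k).
- by exists (b d0), d0.
- by move=> k; apply: closed_comp => // x _; exact: fc.
- have := bc d Dd _ (open_nbhs_nbhs (conj oP Pd)).
  rewrite /= withinE => -[V + DPV]; rewrite nbhsE => -[O [oO Od] OV].
  have [|y [[Dy Ey] Oy]] := DE k O oO; first by exists d.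
  exists (b y); split.
    by split; [exists y|rewrite /= bK].
  have : (V `&` D) y by split=> //; exact: OV.
  by rewrite -DPV => -[].
exists (f s); last exact: Es.
move=> O /fc /Rs[_ [[y Dy <-]]] /=; rewrite bK// => Oy.
by exists y.
Qed.

Section generic_section.
Context (X : topologicalType) (B : nat -> set X) (f : omega_omega -> X).
Context (baseB : open_base B) (fc : continuous f).

(** The largest open set in which the image of the cylinder [t] is meager. *)
Definition meager_locus (t : seq nat) : set X :=
  \bigcup_(n in [set n | meager (f @` cyl t `&` B n)]) B n.

(** The image of the cylinder [t] is non-meager in every nonempty open subset of
    this set. *)
Definition fat_locus (t : seq nat) : set X := ~` closure (meager_locus t).

(** The cells of a given level are pairwise disjoint open sets, since each point
    is assigned to the first successor of [t] whose fat locus contains it;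
    removing the closure of the earlier fat loci is what keeps the cells open. *)
Fixpoint cell (t : seq nat) : set X :=
  if t is n :: t' then
    cell t' `&` (fat_locus t `\` closure (\bigcup_(m in `I_n) fat_locus (m :: t')))
  else setT.

Lemma open_meager_locus t : open (meager_locus t).
Proof. by apply: bigcup_open => n _; exact: baseB.1. Qed.

Lemma open_fat_locus t : open (fat_locus t).
Proof. by apply: closed_openC; exact: closed_closure. Qed.

Lemma open_cell t : open (cell t).
Proof.
elim: t => [|n t IH] /=; first exact: openT.
apply: openI => //; rewrite setDE; apply: openI; first exact: open_fat_locus.
by apply: closed_openC; exact: closed_closure.
Qed.

Lemma fat_locus_nonmeager t O x :
  fat_locus t x -> open O -> O x -> ~ meager (f @` cyl t `&` O).
Proof.
move=> Ux oO Ox tO; apply: Ux; apply: subset_closure.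
have [n Bx BO] := baseB.2 O x oO Ox.
by exists n => //=; apply: meagerS tO; exact: setIS.
Qed.

(** A countable union of meager pieces, plus the boundary of an open set. *)
Lemma meager_closure_locus t : meager (f @` cyl t `&` closure (meager_locus t)).
Proof.
pose J := [set n | meager (f @` cyl t `&` B n)].
apply: (@meagerS _ _ ((\bigcup_(n in J) (f @` cyl t `&` B n)) `|`
    (closure (meager_locus t) `\` meager_locus t))).
  move=> x [tx cx]; have [[n nm Bx]|nx] := pselect (meager_locus t x).
    by left; exists n.
  by right.
apply: meagerU; first exact: meager_bigcup.
exact/nowhere_dense_meager/nowhere_dense_boundary/open_meager_locus.
Qed.

(** The image of a cylinder is the union of the countably many images of its
    successors. If all of these were meager in [O], so would be the image of
    [cyl t], against fatness. *)
Lemma fat_locus_split t O :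
  open O -> O !=set0 -> O `<=` fat_locus t ->
  exists n, O `&` fat_locus (n :: t) !=set0.
Proof.
move=> oO [x Ox] Ot; apply: contrapT => nO.
apply: (fat_locus_nonmeager (Ot x Ox) oO Ox).
apply: meagerS (@meager_bigcup _ nat setT _
  (fun n _ => @meager_closure_locus (n :: t))).
move=> y [[s ts <-] Oy]; exists (s (size t)) => //; split.
  by exists s => //; rewrite cyl_cons.
by apply: contrapT => cy; apply: nO; exists (s (size t)), (f s).
Qed.

Lemma cell_fat t : fat_locus [::] = setT -> cell t `<=` fat_locus t.
Proof. by move=> U0; case: t => [|n t] /=; [rewrite U0|move=> x [_ []]]. Qed.

Lemma cell_inj s t x : cell s x -> cell t x -> size s = size t -> s = t.
Proof.
elim: s t => [|m s IH] [|n t]//= [sx [mx smx]] [tx [nx tnx]] [] /(IH _ sx tx) st.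
rewrite -{}st in nx tnx *; congr cons; apply/eqP; rewrite eqn_leq.
by apply/andP; split; rewrite leqNgt; apply/negP => mn;
  [apply: smx|apply: tnx]; apply: subset_closure; [exists n|exists m].
Qed.

Lemma cell_dense k : fat_locus [::] = setT ->
  dense (\bigcup_(t in [set t | size t = k]) cell t).
Proof.
move=> U0; elim: k => [|k IH] O O0 oO.
  by have [x Ox] := O0; exists x; split=> //; exists [::].
have [x [Ox [t tk tx]]] := IH O O0 oO.
have oOt : open (O `&` cell t) by apply: openI => //; exact: open_cell.
have Ot0 : O `&` cell t !=set0 by exists x.
have OtU : O `&` cell t `<=` fat_locus t by move=> y [_]; exact: cell_fat.
have ex : exists n, `[< O `&` cell t `&` fat_locus (n :: t) !=set0 >].
  by have [n tn] := fat_locus_split oOt Ot0 OtU; exists n; apply/asboolP.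
case: (ex_minnP ex) => n /asboolP[y [[Oy ty] ny]] nmin.
exists y; split=> //; exists (n :: t); first by rewrite /= tk.
split=> //; split=> // /(_ (O `&` cell t)).
case=> [|z [[m /= mn mz] Otz]]; first by apply: open_nbhs_nbhs.
have /nmin : `[< O `&` cell t `&` fat_locus (m :: t) !=set0 >].
  by apply/asboolP; exists z.
by rewrite leqNgt mn.
Qed.

(** Since cells of the same level are disjoint, the cells through [x] at the
    successive levels are nested and spell a branch. *)
Lemma cell_branch x :
  (forall k, exists2 t, size t = k & cell t x) ->
  exists s, forall k, cell (past s k) x.
Proof.
move=> xk.
have /choice[t tP] k : exists t, size t = k /\ cell t x.
  by have [t tk tx] := xk k; exists t.
exists (fun k => head 0 (t k.+1)) => k.
suff -> : past (fun k => head 0 (t k.+1)) k = t k by exact: (tP k).2.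
elim: k => [|k IH] /=; first by rewrite (size0nil (tP 0).1).
rewrite IH; have [] := tP k.+1; case: (t k.+1) => // n u [uk] [ux _].
by rewrite /= (cell_inj ux (tP k).2)// uk (tP k).1.
Qed.

(** Every neighbourhood of [x] meets the image of every cylinder around [s], and
    these images shrink to [f s]. *)
Lemma cell_branch_image s x : hausdorff_space X -> fat_locus [::] = setT ->
  (forall k, cell (past s k) x) -> f s = x.
Proof.
rewrite open_hausdorff => T2 U0 sx; apply: contrapT => /eqP /T2[[O P] /=].
move=> [/set_mem Os /set_mem Px] [oO oP /eqP OP].
have [k sk] := nbhs_cyl (fc (open_nbhs_nbhs (conj oO Os))).
apply: (fat_locus_nonmeager (cell_fat U0 (sx k)) oP Px).
apply: (@meagerS _ _ set0) => [_ [[s' ss' <-] Ps']|].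
  by rewrite -OP; split=> //; exact: sk.
exact/nowhere_dense_meager/nowhere_dense0.
Qed.

Lemma baire_fat_locus : baire_space X -> range f = setT ->
  fat_locus [::] = setT.
Proof.
move=> bX fX; rewrite /fat_locus (_ : meager_locus _ = set0) ?closure0 ?setC0//.
rewrite -subset0 => x [n /= nm Bx].
have : meager (B n).
  apply: meagerS nm => y By; split=> //.
  by have : range f y by [rewrite fX]; case=> s _ <-; exists s.
by move=> /bX /(_ (B n)) []; [exists x|exact: baseB.1|move=> y []].
Qed.

(** The points lying in a cell of every level form a dense set because [X] is
    Baire. Sending such a point to its branch is a section of [f], and it is
    continuous because a cell is an open set on which the initial segment of the
    branch is constant. *)
Lemma baire_continuous_section :
    hausdorff_space X -> baire_space X -> range f = setT ->
  exists D, [/\ countable D, dense D & continuous_section f D].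
Proof.
move=> T2 bX fX; have U0 := baire_fat_locus bX fX.
pose G k := \bigcup_(t in [set t | size t = k]) cell t.
have oG k : open (G k) by apply: bigcup_open => t _; exact: open_cell.
have dG : dense (~` \bigcup_k ~` G k).
  apply: bX; apply: (@meager_cover _ nat (fun k => ~` G k)) => // k.
  apply/nowhere_denseP => O oO O0; exists (O `&` G k); split.
  - exact: openI.
  - exact: cell_dense.
  - exact: subIsetl.
  - by rewrite setCK; exact: subIsetr.
have [D [cD DG DdG]] := countable_dense_subset (~` \bigcup_k ~` G k) baseB.
have /choice[b bP] x : exists s, D x -> forall k, cell (past s k) x.
  have [Dx|] := pselect (D x); last by exists (fun=> 0).
  have [k|s sP] := @cell_branch x; last by exists s.
  by apply: contrapT => nk; apply: (DG x Dx); exists k.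
exists D; split=> //.
  move=> O O0 oO; rewrite setIC; apply: DdG => //.
  by rewrite setIC; exact: dG.
exists b => [|x Dx]; last exact: cell_branch_image T2 U0 (bP x Dx).
apply/subspace_continuousP => x Dx A /nbhs_cyl[k kA].
rewrite /= /within/=; apply: filterS (open_nbhs_nbhs
  (conj (@open_cell (past (b x) k)) (bP x Dx k))) => y xy Dy.
apply: kA; rewrite /cyl/= size_past.
by apply: cell_inj (bP y Dy k) xy _; rewrite !size_past.
Qed.

End generic_section.

(** * The meager part of a countable dense homogeneous space *)

Definition meager_part (X : topologicalType) : set X :=
  \bigcup_(O in [set O | open O /\ meager O]) O.
Arguments meager_part : clear implicits.

Lemma open_meager_part (X : topologicalType) : open (meager_part X).
Proof. by apply: bigcup_open => O []. Qed.

Lemma homeomorphism_meager_part (X : topologicalType) (h : X -> X) :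
  homeomorphism h -> h @` meager_part X = meager_part X.
Proof.
have sub k : homeomorphism k -> k @` meager_part X `<=` meager_part X.
  move=> kh _ [x [O [oO mO] Ox] <-]; exists (k @` O); last by exists x.
  split; last exact: homeomorphism_meager.
  have [_ [g [gc kK gK]]] := kh; rewrite (image_inverse _ kK gK).
  by apply: open_comp => // z _; exact: gc.
move=> hh; apply/seteqP; split; first exact: sub.
have [hc [g [gc hK gK]]] := hh.
move=> x Mx; exists (g x) => //; apply: (sub g); last by exists x.
by split=> //; exists h.
Qed.

Lemma meager_meager_part (X : topologicalType) (B : nat -> set X) :
  open_base B -> meager (meager_part X).
Proof.
move=> baseB.
apply: (@meagerS _ _ (\bigcup_(n in [set n | meager (B n)]) B n)); last first.
  exact: meager_bigcup.
move=> x [O [oO mO] Ox]; have [n Bx BO] := baseB.2 O x oO Ox.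
by exists n => //=; exact: meagerS mO.
Qed.

(** Both sets are completed to dense sets of the space by the same countable set
    [W] lying off the closure of the meager part. A homeomorphism matching the
    completions preserves the meager part, hence matches their traces on it. *)
Lemma cdh_meager_part (X : topologicalType) (S S' : set X) :
    countable_dense_homogeneous X ->
    S `<=` meager_part X -> countable S -> dense_in (meager_part X) S ->
    S' `<=` meager_part X -> countable S' -> dense_in (meager_part X) S' ->
  exists2 h : X -> X, homeomorphism h & h @` S = S'.
Proof.
set U := meager_part X => -[[D cD dD] cdh] SU cS dS S'U cS' dS'.
pose W := D `\` closure U.
have cW : countable W.
  by apply: sub_countable cD; apply: subset_card_le; exact: subDsetl.
have UW V : V `<=` U -> (V `|` W) `&` U = V.
  move=> VU; apply/seteqP; split=> [x [[//|[_ nUx]] Ux]|x Vx].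
    by case: nUx; exact: subset_closure.
  by split; [left|exact: VU].
have dW V : dense_in U V -> dense (V `|` W).
  move=> dV O [x Ox] oO; rewrite setIC.
  have [UO|UO] := pselect (U `&` O !=set0).
    by have [y [Vy Oy]] := dV O oO UO; exists y; split=> //; left.
  have [y [Oy Dy]] : O `&` D !=set0 by apply: dD => //; exists x.
  exists y; split=> //; right; split=> // Uy; apply: UO.
  exact: Uy (open_nbhs_nbhs (conj oO Oy)).
have [h hh hSW] :=
  cdh _ _ (countableU cS cW) (dW _ dS) (countableU cS' cW) (dW _ dS').
exists h => //; rewrite -(UW S)// -(UW S')// -hSW.
have hU : h @` U = U := homeomorphism_meager_part hh.
rewrite -{2}hU.
have [_ [g [_ hK gK]]] := hh.
by rewrite !(image_inverse _ hK gK).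
Qed.

(** In a metric space this makes a subset [S] of [U] a relative G-delta set. The
    form with closed covers is the one that category arguments consume. *)
Definition thin_in (X : topologicalType) (U S : set X) :=
  exists N : nat -> set X, [/\ forall i, closed (N i), U `<=` \bigcup_i N i &
    forall i, finite_set (S `&` N i)].

(** The [n]-th point is chosen in the [n]-th basic open set, off the members of
    index at most [n] of a closed nowhere dense cover of [U]; each member
    therefore contains only finitely many of the chosen points. *)
Lemma exists_thin_dense (X : topologicalType) (B : nat -> set X) (U : set X) :
    open_base B -> open U -> meager U -> U !=set0 ->
  exists D, [/\ countable D, D `<=` U, dense_in U D & thin_in U D].
Proof.
move=> baseB oU [F F0 UF] [x0 Ux0]; pose N i := closure (F i).
have N0 i : nowhere_dense (N i).
  by rewrite /nowhere_dense -((closure_id _).1 (@closed_closure _ _)); exact: F0.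
have /choice[d dP] n : exists d, U d /\ (U `&` B n !=set0 ->
    B n d /\ forall i, i <= n -> ~ N i d).
  have [UB|nUB] := pselect (U `&` B n !=set0); last by exists x0; split=> // /nUB.
  have [|P [_ [x Px] PUB PN]] := @nowhere_dense_avoid _ N n.+1 _ N0 _ UB.
    by apply: openI => //; exact: baseB.1.
  have [Ux Bx] := PUB x Px; exists x; split=> // _; split=> // i ni.
  exact: PN Px.
pose J := [set n | U `&` B n !=set0].
exists (d @` J); split.
- exact: sub_countable (card_image_le _ _) _.
- by move=> _ [n _ <-]; exact: (dP n).1.
- move=> O oO [x [Ux Ox]]; have [n Bx BO] := baseB.2 O x oO Ox.
  have UB : U `&` B n !=set0 by exists x.
  by exists (d n); split; [exists n|apply: BO; have [] := (dP n).2 UB].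
- exists N; split=> [i||i]; first exact: closed_closure.
    by rewrite UF => x [i _ Fx]; exists i => //; exact: subset_closure.
  apply: sub_finite_set (finite_image d (finite_II i)) => _ [[n Jn <-] Nd].
  exists n => //=; rewrite ltnNge; apply/negP => ni.
  by have [_ /(_ i ni)] := (dP n).2 Jn.
Qed.

Lemma cdh_thin (X : topologicalType) (B : nat -> set X) (S : set X) :
    countable_dense_homogeneous X -> open_base B -> meager_part X !=set0 ->
    countable S -> S `<=` meager_part X -> thin_in (meager_part X) S.
Proof.
move=> cdh baseB U0 cS SU.
have [D [cD DU dD [N [cN UN fN]]]] :=
  exists_thin_dense baseB (@open_meager_part X) (meager_meager_part baseB) U0.
have SDU : S `|` D `<=` meager_part X by rewrite subUset.
have dSD : dense_in (meager_part X) (S `|` D).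
  by move=> O oO UO; have [x [Dx Ox]] := dD O oO UO; exists x; split=> //; right.
have [h hh hD] := cdh_meager_part cdh DU cD dD SDU (countableU cS cD) dSD.
have hU := homeomorphism_meager_part hh.
have [_ [g [gc hK gK]]] := hh.
exists (fun i => h @` N i); split=> [i||i].
- by rewrite (image_inverse _ hK gK); apply: closed_comp => // x _; exact: gc.
- rewrite -{1}hU => _ [x /UN[i _ Nx] <-]; exists i => //; exact: imageP.
- apply: sub_finite_set (finite_image h (fN i)) => y [Sy [x Nx xy]].
  exists x => //; split=> //.
  have : (h @` D) y by rewrite hD; left.
  by rewrite -xy (image_inverse _ hK gK) /= hK.
Qed.

(** Suppose that [U] is uncountable, and let [C] be the set of those points of
    the preimage of [U] all of whose neighbourhoods have an image that meets [U]
    in an uncountable set. A countable dense subset [R] of [C] has infinite image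
    on each cylinder that it meets, so it is not contained there in the preimage
    of a closed set meeting [f @` R] in a finite set. By category some point of
    [closure R] lands in [U] but off a whole closed cover of [U], which is
    absurd. *)
Lemma thin_countable (X : topologicalType) (f : omega_omega -> X) (U : set X) :
    accessible_space X -> continuous f -> range f = setT -> open U ->
    (forall S, countable S -> S `<=` U -> thin_in U S) ->
  countable U.
Proof.
move=> T1 fc fX oU thinU; apply: contrapT => ncU.
pose C := [set s | U (f s) /\ forall t, cyl t s -> ~ countable (f @` cyl t `&` U)].
pose Z := \bigcup_(t in [set t | countable (f @` cyl t `&` U)]) (f @` cyl t `&` U).
have cZ : countable Z by exact: bigcup_countable.
have CZ s : U (f s) -> ~ C s -> Z (f s).
  move=> Us nCs; apply: contrapT => nZ; apply: nCs; split=> // t ts ct.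
  by apply: nZ; exists t => //; split=> //; exists s.
have [B baseB] := omega_omega_base.
have [R [cR RC dR]] := countable_dense_subset C baseB.
have infR s t : R s -> cyl t s -> ~ finite_set (f @` (R `&` cyl t)).
  move=> Rs ts fin; have [_ /(_ t ts)] := RC s Rs; apply.
  apply: sub_countable (countableU (finite_set_countable fin) cZ).
  apply: subset_card_le => _ [[s' ts' <-] Us'].
  have [Cs'|] := pselect (C s'); last by right; exact: CZ.
  (* A finite set is closed, so values of [f] on [C] outside the finite image
     of [R] would be approximated by values on [R], by density of [R] in [C]. *)
  left; apply: contrapT => nRs'.
  have cfin := accessible_finite_set_closed.1 T1 _ fin.
  have [||r [Rr [tr]]] := dR (cyl t `&` f @^-1` (~` (f @` (R `&` cyl t)))).
  - apply: openI; first exact: cyl_open.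
    by apply: open_comp; [move=> x _; exact: fc|exact: closed_openC].
  - by exists s'.
  - by apply; exists r.
have [N [cN UN fN]] : thin_in U (f @` R).
  apply: thinU; first exact: sub_countable (card_image_le _ _) cR.
  by move=> _ [s /RC[Us _] <-].
(* The extra closed set number 0 forces the limit point into [U]. *)
pose E k := f @^-1` (if k is i.+1 then N i else ~` U).
have [|k|k O oO [s [Rs Os]]|s _ nEs] := @omega_omega_baire R E.
- have [s Cs] : C !=set0.
    apply: contrapT => C0; apply: ncU; apply: sub_countable cZ.
    apply: subset_card_le => x Ux; have : range f x by rewrite fX.
    by case=> s _ sx; rewrite -sx in Ux *; apply: CZ => // Cs; apply: C0; exists s.
  by have [|r [Rr _]] := dR setT openT; [exists s|exists r].
- apply: closed_comp => [x _|]; first exact: fc.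
  by case: k => [|i]; [exact: open_closedC|exact: cN].
- have [m sm] := nbhs_cyl (open_nbhs_nbhs (conj oO Os)).
  case: k => [|i].
    by exists s; split=> //; split=> //; apply; case: (RC s Rs).
  apply: contrapT => RON; apply: (infR s (past s m) Rs (cyl_past s m)).
  apply: sub_finite_set (fN i) => _ [r [Rr sr] <-]; split; first by exists r.
  apply: contrapT => nN; apply: RON; exists r; split=> //; exact: sm.
- have Us : U (f s) by apply: contrapT; exact: (nEs 0).
  by have [i _ Ns] := UN _ Us; exact: (nEs i.+1).
Qed.

(** If [X] is not Baire, its meager part [U] is nonempty. All countable subsets
    of [U] are thin, so [U] is countable; moreover [U] has no isolated point, as
    an isolated point is not meager. Then [U] and [U] minus a point are both
    countable and dense in [U], and no homeomorphism that preserves [U] can map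
    one onto the other. *)
Lemma analytic_cdh_baire (X : topologicalType) (B : nat -> set X) :
    accessible_space X -> open_base B -> analytic_space X ->
    countable_dense_homogeneous X -> baire_space X.
Proof.
move=> T1 baseB [f fc fX] cdh A mA O O0 oO; apply: contrapT => OA.
have mO : meager O.
  by apply: meagerS mA => x Ox; apply: contrapT => nAx; apply: OA; exists x.
set U := meager_part X.
have [p Up] : U !=set0 by case: O0 => x Ox; exists x, O.
have cU : countable U.
  apply: thin_countable T1 fc fX (@open_meager_part X) _ => S cS SU.
  by apply: cdh_thin cdh baseB _ cS SU; exists p.
have cUp : countable (U `\ p).
  by apply: sub_countable cU; apply: subset_card_le; exact: subDsetl.
have dUp : dense_in U (U `\ p).
  move=> P oP [x [Ux Px]]; apply: contrapT => UP.
  have Up1 : U `&` P = [set p].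
    have UPp y : (U `&` P) y -> y = p.
      by move=> [Uy Py]; apply: contrapT => yp; apply: UP; exists y.
    by apply/seteqP; split=> [//|y ->]; rewrite -(UPp x).
  have [F F0 pF] : meager [set p].
    by rewrite -Up1; apply: meagerS (meager_meager_part baseB) => y [].
  have [n _ Fp] : (\bigcup_n F n) p by rewrite -pF.
  suff : (closure (F n))° p by rewrite F0.
  have op : open [set p].
    by rewrite -Up1; apply: openI => //; exact: open_meager_part.
  apply: filterS (open_nbhs_nbhs (conj op erefl)) => _ ->.
  exact: subset_closure.
have [h hh hU] := cdh_meager_part cdh (@subset_refl _ U) cU (fun O _ => id)
  (@subDsetl _ _ _) cUp dUp.
have UUp : h @` U = U := homeomorphism_meager_part hh.
by move: Up; rewrite -UUp hU => -[_]; apply.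
Qed.

(** * Complete Baireness *)

(** A section exists on one countable dense set, and homogeneity carries it to
    any other, hence to any countable set, at the cost of replacing [f] by its
    composite with a homeomorphism. *)
Lemma analytic_cdh_section (X : topologicalType) (B : nat -> set X) (S : set X) :
    hausdorff_space X -> open_base B -> analytic_space X ->
    countable_dense_homogeneous X -> countable S ->
  exists2 f : omega_omega -> X, continuous f & continuous_section f S.
Proof.
move=> T2 baseB anX cdhX cS; have [f fc fX] := anX.
have bX := analytic_cdh_baire (hausdorff_accessible T2) baseB anX cdhX.
have [D [cD dD [b bc bK]]] := baire_continuous_section baseB fc T2 bX fX.
have dSD : dense (S `|` D).
  by move=> O O0 oO; have [x [Ox Dx]] := dD O O0 oO; exists x; split=> //; right.
have [h [hc [g [gc hK gK]]] hD] := cdhX.2 _ _ (countableU cS cD) dSD cD dD.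
have SD x : S x -> D (h x) by move=> Sx; rewrite -hD; exists x => //; left.
exists (g \o f).
  by move=> s; apply: continuous_comp; [exact: fc|exact: gc].
exists (b \o h) => [|x Sx /=]; last by rewrite bK ?hK//; exact: SD.
apply/subspace_continuousP => x Sx A bA.
have hA : nbhs x (h @^-1` [set y | D y -> A (b y)]).
  by apply: hc; exact: (subspace_continuousP _ _).1 bc _ (SD x Sx) A bA.
rewrite /= /within /=; apply: (filterS _ hA) => y /= yA Sy.
by apply: yA; exact: SD.
Qed.

Theorem theorem2p3 (R : realType) (X : metricType R)
    (X_separable : separable_space X)
    (X_analytic : analytic_space X)
    (X_cdh : countable_dense_homogeneous X) :
  completely_baire X.
Proof.
have T2 : hausdorff_space X by exact: metric_hausdorff.
have [B baseB] := separable_metric_open_base X_separable.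
move=> C cC A [F F0 AF] O [c0 Oc0] [P oP PO]; apply: contrapT => OA.
have OF c : O c -> exists n, F n c.
  move=> Oc; apply: contrapT => nFc; apply: OA; exists c; split=> //.
  by rewrite AF => -[n _ Fc]; apply: nFc; exists n.
have [S [cS SCP dS]] := countable_dense_subset (C `&` P) baseB.
have [f fc fS] := analytic_cdh_section T2 baseB X_analytic X_cdh cS.
(* A nonempty relatively open set [O], which is the trace of [P] on [C], is
   covered by the nowhere dense sets [F n]. A countable dense subset [S] of this
   trace has a continuous section, so some limit of points of [S] avoids all the
   sets [F n]; avoiding also the complement of [P] keeps the limit in [O]. *)
pose E k := if k is n.+1 then closure (set_val @` F n) else ~` P.
have [||k Q oQ [y [Sy Qy]]|x Sx nEx] := @continuous_section_avoid _ f S E fc fS.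
- have [|y [Sy _]] := dS setT openT; last by exists y.
  exists (set_val c0); split=> //; split; first exact: set_valP.
  by move: Oc0; rewrite -PO.
- by case=> [|n]; [exact: open_closedC|exact: closed_closure].
- have [Cy Py] := SCP y Sy.
  case: k => [|n]; first by exists y; split=> //; split=> //; apply.
  have [||_ [[G oG <-] [c Gc] GPQ GF]] := (nowhere_denseP (F n)).1 (F0 n)
    (set_val @^-1` (P `&` Q)).
  + by exists (P `&` Q) => //; exact: openI.
  + by exists (exist _ y (mem_set Cy)).
  have [Pc Qc] := GPQ c Gc.
  have [||z [Sz [Gz Qz]]] := dS (G `&` Q); first exact: openI.
    by exists (set_val c); split; split=> //; exact: set_valP.
  exists z; split=> //; split=> // /(_ G (open_nbhs_nbhs (conj oG Gz))).
  case=> _ [[d Fd <-] Gd].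
  exact: GF Gd Fd.
- have Cx : C x.
    by rewrite (closure_id C).1//; apply: closureS Sx => y /SCP[].
  have Px : P x by apply: contrapT; exact: (nEx 0).
  pose d : set_type C := exist _ x (mem_set Cx).
  have [|n Fd] := OF d; first by rewrite -PO.
  by apply: (nEx n.+1); apply: subset_closure; exists d.
Qed.
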